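(* Let $T>0$, $I=[0,T]$, let $r\in\mathcal{C}(I)$, and let $\alpha_0>0$, $\gamma_0>0$, $0<\lambda_{\min}<\lambda_{\max}<\infty$ and $\beta_0=0$. For $f\in\mathcal{C}(I)$ let $\Lambda_f:I\to[0,\infty)$ be $$\Lambda_f(s) := \lambda_{\min} + (\lambda_{\max}-\lambda_{\min})\,\frac{\tanh\bigl(\gamma_0|f(s)-r(s)|\bigr)}{1+\beta_0\int_0^s e^{-\alpha_0(s-\tau)}\tanh\bigl(\gamma_0|f(\tau)-r(\tau)|\bigr)\,d\tau},\qquad s\in I.$$ Then the function $$\Lambda(s,x)=\lambda_{\min}+(\lambda_{\max}-\lambda_{\min})\tanh\bigl(\gamma_0|x-r(s)|\bigr),\qquad (s,x)\in I\times\mathbb{R},$$ belongs to $\mathscr{A}(I)$, and for every $f\in\mathcal{C}(I)$ one has $\Lambda_f(s)=\Lambda(s,f(s))$ for all $s\in I$.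
   Context: $\mathcal{C}(I)$ is the set of continuous functions $I\to\mathbb{R}$. Adaptive sensitivity functions: $\mathscr{A}(I)$ is the set of functions $\Lambda:I\times\mathbb{R}\to[0,\infty)$ such that: (uniform boundedness) there are constants $0<c_1\le c_2<\infty$ with $c_1\le\Lambda(s,x)\le c_2$ for all $(s,x)\in I\times\mathbb{R}$; (Lipschitz in the state) there is $L>0$ with $|\Lambda(s,x)-\Lambda(s,y)|\le L|x-y|$ for all $s\in I$, $x,y\in\mathbb{R}$; (measurability in time) for every fixed $x\in\mathbb{R}$, $s\mapsto\Lambda(s,x)$ is Lebesgue measurable on $I$; (positivity at zero) there is $\varrho>0$ with $\Lambda(s,0)\ge\varrho$ for all $s\in I$. *)

(* Defs.v *)
From mathcomp Require Import all_boot all_order all_algebra.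
From mathcomp Require Import all_classical all_reals all_analysis.
Set Implicit Arguments.
Unset Strict Implicit.
Unset Printing Implicit Defensive.
Import Order.TTheory GRing.Theory Num.Theory.
Import numFieldNormedType.Exports.
Local Open Scope classical_set_scope.
Local Open Scope ring_scope.

Definition tanh (R : realType) (u : R) : R :=
  (expR u - expR (- u)) / (expR u + expR (- u)).

(* R with the Lebesgue (completed Borel) sigma-algebra: this is the domain of
   completed_lebesgue_measure. The canonical sigma-algebra on R is Borel. *)
Definition lebesgueTypeR (R : realType) :=
  caratheodory_type ((@wlength R idfun)^*)%mu.

(* A function on [0, t] is represented by a total function on R whose values
   outside [0, t] are irrelevant: every condition below is relative to [0, t]. *)
Definition continuous_functions (R : realType) (t : R) : set (R -> R) :=
  [set f : R -> R | {within `[0, t], continuous f}].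

Definition adaptive_sensitivities (R : realType) (t : R) :
    set (R -> R -> R) :=
  [set Lam : R -> R -> R |
    [/\ (forall s x, s \in `[0, t] -> 0 <= Lam s x),
        (exists c1 c2, [/\ 0 < c1, c1 <= c2 &
           forall s x, s \in `[0, t] -> c1 <= Lam s x <= c2]),
        (exists2 L, 0 < L &
           forall s x y, s \in `[0, t] ->
             `|Lam s x - Lam s y| <= L * `|x - y|),
        (forall x, measurable_fun (`[0, t]%classic : set (lebesgueTypeR R))
                     (fun s : lebesgueTypeR R => Lam s x)) &
        (exists2 rho, 0 < rho &
           forall s, s \in `[0, t] -> rho <= Lam s 0)]].

(* The sensitivity of the path f, with memory of its past over [0, s]. *)
Definition path_sensitivity (R : realType)
    (lmin lmax alpha0 beta0 gamma0 : R) (r f : R -> R) (s : R) : R :=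
  lmin + (lmax - lmin) *
    (tanh (gamma0 * `|f s - r s|) /
     (1 + beta0 * \int[lebesgue_measure]_(tau in `[0, s])
            (expR (- alpha0 * (s - tau)) * tanh (gamma0 * `|f tau - r tau|)))).

Definition state_sensitivity (R : realType)
    (lmin lmax gamma0 : R) (r : R -> R) (s x : R) : R :=
  lmin + (lmax - lmin) * tanh (gamma0 * `|x - r s|).

(* Main.v *)
Require Import Defs.
From mathcomp Require Import all_boot all_order all_algebra.
From mathcomp Require Import all_classical all_reals all_analysis.
From mathcomp Require Import measurable_realfun ring lra.
Import Order.TTheory GRing.Theory Num.Theory.
Import numFieldNormedType.Exports.
Local Open Scope classical_set_scope.
Local Open Scope ring_scope.

(** Without memory (beta0 = 0) the denominator in the sensitivity of a path is
    1, which gives the second claim at once. For the first one, everything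
    follows from three properties of tanh: on nonnegative arguments its values
    lie in [0, 1], which confines the sensitivity to [lmin, lmax] and settles
    nonnegativity, boundedness and positivity at zero; it is 1-Lipschitz, which
    together with the triangle inequality makes the sensitivity
    (lmax - lmin) * gamma0-Lipschitz in the state; and it is continuous, so that
    for a fixed state the sensitivity is a measurable function of the time,
    as r is continuous on [0, T]. The Lipschitz bound and continuity of tanh
    both come from its derivative 1 - tanh ^ 2, which lies in [0, 1]. *)

Lemma expR_add_expRN_gt0 (R : realType) (u : R) : 0 < expR u + expR (- u).
Proof. by rewrite addr_gt0 ?expR_gt0. Qed.

Lemma tanh_ge0 (R : realType) (u : R) : 0 <= u -> 0 <= tanh u.
Proof.
move=> u0; apply: divr_ge0; last exact/ltW/expR_add_expRN_gt0.
by rewrite subr_ge0 ler_expR; lra.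
Qed.

Lemma tanh_norm_le1 (R : realType) (u : R) : `|tanh u| <= 1.
Proof.
rewrite normrM normfV (gtr0_norm (expR_add_expRN_gt0 _ u)).
rewrite ler_pdivrMr ?expR_add_expRN_gt0// mul1r.
by rewrite ler_norml; have := expR_ge0 u; have := expR_ge0 (- u); lra.
Qed.

Lemma is_derive_tanh (R : realType) (u : R) :
  is_derive u 1 (@tanh R) (1 - tanh u ^+ 2).
Proof.
have dexpN : is_derive u 1 (expR \o -%R) (- expR (- u)).
  by apply: is_derive_eq; rewrite mulrN mulr1.
have denom_neq0 : (expR \+ (expR \o -%R)) u != 0 :> R.
  by rewrite gt_eqF//= expR_add_expRN_gt0.
have dinv := is_deriveV denom_neq0 (is_deriveD (is_derive_expR u) dexpN).
apply: (is_derive_eq (is_deriveM (is_deriveB (is_derive_expR u) dexpN) dinv)).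
have e_neq0 : expR u + expR (- u) != 0 := denom_neq0.
rewrite /tanh opprK; set a := expR u in e_neq0 *.
set b := expR (- u) in e_neq0 *.
(* The product rule is stated with the scaling of R over itself and with
   pointwise operations on functions; [field] needs them unfolded. *)
change ((a - b) * (- (a + b) ^- 2 * (a - b)) + (a + b)^-1 * (a + b) =
  1 - ((a - b) / (a + b)) ^+ 2).
by field.
Qed.

Lemma continuous_tanh (R : realType) : continuous (@tanh R).
Proof.
move=> u; apply/differentiable_continuous/derivable1_diffP.
exact: (@ex_derive _ _ _ _ _ _ _ (is_derive_tanh _ u)).
Qed.

(** The mean value theorem applies with constant 1, as 0 <= 1 - tanh ^ 2 <= 1. *)
Lemma tanh_lipschitz (R : realType) (u v : R) : `|tanh u - tanh v| <= `|u - v|.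
Proof.
wlog vu : u v / v <= u.
  by move=> h; case: (leP v u) => [/h//|/ltW/h]; rewrite distrC (distrC u).
have [c _ ->] := MVT_segment vu (fun x _ => is_derive_tanh _ x)
  (continuous_subspaceT (@continuous_tanh R)).
rewrite normrM ler_piMl// ger0_norm ?subr_ge0 ?gerBl ?sqr_ge0//.
by rewrite -real_normK ?num_real// exprn_ile1 ?tanh_norm_le1.
Qed.

(** Measurability in time refers to the Lebesgue sigma-algebra, whereas
    continuity yields Borel measurability; the former sigma-algebra is finer. *)
Lemma lebesgue_measurable_fun (R : realType) (D : set R) (f : R -> R) :
  measurable D -> measurable_fun D f ->
  measurable_fun (D : set (lebesgueTypeR R)) (f : lebesgueTypeR R -> R).
Proof.
by move=> mD mf _ Y mY; apply: sub_caratheodory; exact: mf.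
Qed.

Theorem corollary3p1 (R : realType) (T : R) (r : R -> R)
    (alpha0 beta0 gamma0 lmin lmax : R)
    (T_gt0 : 0 < T)
    (r_cont : continuous_functions T r)
    (alpha0_gt0 : 0 < alpha0) (gamma0_gt0 : 0 < gamma0)
    (lmin_gt0 : 0 < lmin) (lmin_lt_lmax : lmin < lmax)
    (beta0_eq0 : beta0 = 0) :
  adaptive_sensitivities T (state_sensitivity lmin lmax gamma0 r) /\
  (forall f : R -> R, continuous_functions T f ->
     forall s : R, s \in `[0, T] ->
       path_sensitivity lmin lmax alpha0 beta0 gamma0 r f s =
       state_sensitivity lmin lmax gamma0 r s (f s)).
Proof.
have gap_gt0 : 0 < lmax - lmin by rewrite subr_gt0.
have bounds s x : lmin <= state_sensitivity lmin lmax gamma0 r s x <= lmax.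
  have gd_ge0 : 0 <= gamma0 * `|x - r s| by rewrite mulr_ge0// ltW.
  have t_ge0 := tanh_ge0 _ _ gd_ge0.
  have t_le1 := le_trans (ler_norm _) (tanh_norm_le1 _ (gamma0 * `|x - r s|)).
  by rewrite /state_sensitivity; apply/andP; split; nra.
split; last first.
  by move=> f _ s _; rewrite /path_sensitivity beta0_eq0 mul0r addr0 divr1.
split.
- by move=> s x _; have /andP[+ _] := bounds s x; apply/le_trans/ltW.
- by exists lmin, lmax; split => //; exact: ltW.
- exists ((lmax - lmin) * gamma0) => [|s x y _]; first exact: mulr_gt0.
  rewrite /state_sensitivity opprD addrACA subrr add0r -mulrBr.
  rewrite normrM gtr0_norm// -mulrA.
  rewrite ler_pM2l// (le_trans (tanh_lipschitz _ _ _))//.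
  rewrite -mulrBr normrM gtr0_norm// ler_pM2l//.
  by rewrite (le_trans (ler_dist_dist _ _))// opprB addrA subrK.
- move=> x; apply: lebesgue_measurable_fun => //.
  have mr : measurable_fun `[0, T] r.
    exact: subspace_continuous_measurable_fun.
  rewrite /state_sensitivity; apply: measurable_funD => //.
  apply: measurable_funM => //.
  apply: (measurableT_comp (continuous_measurable_fun (@continuous_tanh R))).
  apply: measurable_funM => //; apply: measurableT_comp => //.
  exact: measurable_funB.
- by exists lmin => // s _; have /andP[] := bounds s 0.
Qed.
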